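(* The alternating group $A_4$ satisfies the weak conjecture: for every integer $n\ge 1$ there exists a generating set $B$ of $A_4^n$ with $|B|=\operatorname{rank}(A_4^n)$ and $$\operatorname{diam}(A_4^n,B)\le n\,(|A_4|-\operatorname{rank}(A_4)).$$
   Context: $A_4$ is the alternating group of degree four and $A_4^n$ its $n$-th direct power. For a finite group $G$ with generating set $B$ and $g\in G$, $l_B(g)$ is the length of a shortest word in the elements of $B$ (no inverses allowed) representing $g$; the identity is represented by the empty word, of length $0$. The diameter is $\operatorname{diam}(G,B)=\max\{l_B(g): g\in G\}$. $\operatorname{rank}(G)$ is the minimum cardinality of a generating set of $G$. *)

(* Defs.v *)
From HB Require Import structures.
From mathcomp Require Import all_boot all_fingroup all_solvable.

Set Implicit Arguments.
Unset Strict Implicit.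
Unset Printing Implicit Defensive.

Import GroupScope.

Section DirectPower.

Variables (gT : finGroupType) (G : {group gT}) (n : nat).

Definition direct_power : {set {dffun forall i : 'I_n, gT}} :=
  setXn (fun _ : 'I_n => G : {set gT}).

Lemma direct_power_group_set : group_set direct_power.
Proof. exact: (group_setXn (fun _ : 'I_n => G)). Qed.

Canonical direct_power_group := Group direct_power_group_set.

End DirectPower.

Section WordLength.

Variable gT : finGroupType.
Implicit Types (G B : {set gT}) (g : gT) (k : nat).

Definition word_of_size B g k : bool :=
  [exists w : k.-tuple gT, all [in B] w && (\prod_(x <- w) x == g)].

(* Words without inverses suffice, since the group is finite. *)
Lemma word_exists B g : g \in <<B>> -> exists k, word_of_size B g k.
Proof.
case/gen_prodgP=> k [c Bc ->]; exists k.
apply/existsP; exists [tuple c i | i < k].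
rewrite big_tuple; under eq_bigr do rewrite tnth_mktuple.
by rewrite eqxx andbT; apply/allP=> _ /mapP[i _ ->]; apply: Bc.
Qed.

(* The value 0 outside <<B>> is a dummy. *)
Definition word_length B g : nat :=
  if @idP (g \in <<B>>) is ReflectT Bg then ex_minn (word_exists Bg) else 0.

Lemma word_lengthP B g : g \in <<B>> ->
  word_of_size B g (word_length B g) /\
  (forall k, word_of_size B g k -> word_length B g <= k).
Proof.
rewrite /word_length => Bg.
by destruct (@idP (g \in <<B>>)) => //; case: ex_minnP.
Qed.

(* Meaningful when <<B>> = G. *)
Definition diam G B : nat := \max_(g in G) word_length B g.

End WordLength.

(* Main.v *)
(* Let a be a three-cycle and v a double transposition, so that A_4 is generated
   by a and v, with A_4 = V <a> for the Klein group V = {1, v, v', vv'}, where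
   v' = a v a^-1.  For n >= 2 take the n elements g_i with a at coordinate i, v
   at coordinate i + 1 mod n and 1 elsewhere.  Consider three sweeps
     (prod g_i^(p_i)) (prod g_i^(q_i)) (prod g_i^(r_i))
   with p_i, q_i in {1, 4} and r_i <= 2, a word of length at most 10 n.  At
   coordinate i + 1 it reads v^(p_i) a v^(q_i) a v^(r_i) a^(r_(i+1)) (a cyclic
   variant at coordinate 0), so r_(i+1) fixes the class modulo V and then the
   parities of p_i and q_i reach every element of that class.  The rank is at
   least n because A_4^n / V^n is elementary abelian of order 3^n.  For n = 1
   the generators are a and v, and A_4 is not cyclic. *)
From HB Require Import structures.
Require Import Defs.
From mathcomp Require Import all_boot all_fingroup all_solvable.
Import GroupScope.

Set Implicit Arguments.
Unset Strict Implicit.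


(** * Words, generation and diameter *)

Lemma word_length_prod (gT : finGroupType) (B : {set gT}) (s : seq gT) :
  all [in B] s -> (word_length B (\prod_(x <- s) x) <= size s)%N.
Proof.
move=> Bs; have /word_lengthP[_]: \prod_(x <- s) x \in <<B>>.
  by rewrite big_seq group_prod // => x /(allP Bs) /mem_gen.
by apply; apply/existsP; exists (in_tuple s); rewrite Bs /= eqxx.
Qed.

(** A short word for each element witnesses generation and the length bound at once. *)
Lemma gen_diam_le (gT : finGroupType) (G : {group gT}) (B : {set gT}) d :
  B \subset G ->
  (forall g, g \in G ->
     exists2 s, all [in B] s & \prod_(x <- s) x = g /\ (size s <= d)%N) ->
  <<B>> = G /\ (diam G B <= d)%N.
Proof.
move=> sBG words; split; last first.
  apply/bigmax_leqP=> g /words[s Bs [<- le_s_d]].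
  exact: leq_trans (word_length_prod Bs) le_s_d.
apply/eqP; rewrite eqEsubset gen_subG sBG; apply/subsetP=> _
  /words[s Bs [<- _]].
by rewrite big_seq group_prod // => x /(allP Bs) /mem_gen.
Qed.

(** * Lower bounds on the rank *)

Lemma grank_gt1 (gT : finGroupType) (G : {group gT}) :
  ~~ abelian G -> (1 < 'm(G))%N.
Proof.
apply: contraR; rewrite -leqNgt; have [B <- <-] := grank_witness G.
move/card_le1_eqP=> B1; rewrite abelian_gen; apply/centsP=> x Bx y By.
by rewrite (B1 _ _ Bx By).
Qed.

Lemma dffunX (I : finType) (gT : finGroupType)
    (x : {dffun forall i : I, gT}) k i :
  (x ^+ k) i = x i ^+ k.
Proof. by elim: k => [|k IHk]; rewrite ?expg0 ?expgS ffunE ?IHk. Qed.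

(** The quotient of [G^n] by [K^n] is elementary abelian of order [#|G / K| ^ n], so its rank is the
    logarithm of that order; passing to a quotient does not raise the rank. *)
Lemma grank_direct_power (gT : finGroupType) (G K : {group gT}) p n :
  prime p -> K <| G -> p.-abelem (G / K) ->
  (n * logn p #|G / K| <= 'm(direct_power G n))%N.
Proof.
move=> p_pr nsKG abGK; have [sKG nKG] := andP nsKG.
pose Gn := direct_power_group G n; pose Kn := direct_power_group K n.
have sub_G'K : G^`(1) \subset K by rewrite der1_min ?(abelem_abelian abGK).
have nKGn : Gn \subset 'N(Kn).
  apply/subsetP=> x /setXnP Gx; rewrite inE.
  apply/subsetP=> _ /imsetP[y /setXnP Ky ->]; apply/setXnP=> i.
  by rewrite !ffunE memJ_norm ?(subsetP nKG).
have sKGn : Kn \subset Gn.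
  by apply/subsetP=> x /setXnP Kx; apply/setXnP=> i; apply: (subsetP sKG).
have abGKn : p.-abelem (Gn / Kn).
  have [_ expGK] := abelemP p_pr abGK.
  apply/abelemP=> //; split.
    apply: sub_der1_abelian; rewrite gen_subG.
    apply/subsetP=> _ /imset2P[x y /setXnP Gx /setXnP Gy ->].
    apply/setXnP=> i; apply: (subsetP sub_G'K).
    by rewrite !ffunE; apply: mem_commg.
  move=> _ /morphimP[x Nx Gx ->]; rewrite -morphX //; apply: coset_id.
  apply/setXnP=> i; move/setXnP/(_ i): Gx => Gx.
  rewrite dffunX.
  have Nxi := subsetP nKG _ Gx.
  by apply: coset_idr; rewrite ?groupX ?morphX ?expGK ?mem_quotient.
have <- : logn p #|Gn / Kn| = (n * logn p #|G / K|)%N.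
  rewrite -lognX; congr logn; apply/eqP.
  (* After multiplication by [#|Kn|], Lagrange turns the two sides into [#|Gn|] and [#|G| ^ n]. *)
  rewrite -(eqn_pmul2l (cardG_gt0 Kn)) !card_quotient // Lagrange //.
  by rewrite !cardsXn !prod_nat_const card_ord -expnMn Lagrange.
rewrite -(rank_abelem abGKn) -grank_abelian ?(abelem_abelian abGKn) //.
exact: quotient_grank.
Qed.

(** * The structure of [A_4] *)

(* Locked, lest rewriting with mulgA see through the products. *)
HB.lock Definition threecycle : {perm 'I_4} :=
  tperm (@Ordinal 4 0 isT) (@Ordinal 4 1 isT)
    * tperm (@Ordinal 4 1 isT) (@Ordinal 4 2 isT).

HB.lock Definition dtransp1 : {perm 'I_4} :=
  tperm (@Ordinal 4 0 isT) (@Ordinal 4 1 isT)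
    * tperm (@Ordinal 4 2 isT) (@Ordinal 4 3 isT).

HB.lock Definition dtransp2 : {perm 'I_4} :=
  tperm (@Ordinal 4 0 isT) (@Ordinal 4 3 isT)
    * tperm (@Ordinal 4 1 isT) (@Ordinal 4 2 isT).

Local Notation a := threecycle.
Local Notation v := dtransp1.
Local Notation w := dtransp2.

Definition unlock4 :=
  (threecycle.unlock, dtransp1.unlock, dtransp2.unlock).

Lemma eq_perm4 (s t : {perm 'I_4}) :
  s (@Ordinal 4 0 isT) = t (@Ordinal 4 0 isT) ->
  s (@Ordinal 4 1 isT) = t (@Ordinal 4 1 isT) ->
  s (@Ordinal 4 2 isT) = t (@Ordinal 4 2 isT) ->
  s (@Ordinal 4 3 isT) = t (@Ordinal 4 3 isT) -> s = t.
Proof.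
move=> e0 e1 e2 e3; apply/permP=> -[[|[|[|[|k]]]] lt_k] //;
by rewrite (bool_irrelevance lt_k isT).
Qed.

Ltac perm4 := rewrite !unlock4 ?expgS ?expg0 ?mulg1; apply: eq_perm4;
  do ?rewrite permE /=; apply: val_inj.

Ltac neq_perm4 := apply/eqP; rewrite !unlock4 => /permP/(_ (@Ordinal 4 0 isT));
  do ?rewrite permE /=.

Lemma threecycle_cubed : a ^+ 3 = 1. Proof. by perm4. Qed.
Lemma dtransp1_squared : v ^+ 2 = 1. Proof. by perm4. Qed.
Lemma dtransp2_squared : w ^+ 2 = 1. Proof. by perm4. Qed.
Lemma dtranspC : v * w = w * v. Proof. by perm4. Qed.
Lemma threecycle_dtransp1 : a * v = w * a. Proof. by perm4. Qed.
Lemma threecycle_dtransp2 : a * w = v * w * a. Proof. by perm4. Qed.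

Lemma order_threecycle : #[a] = 3.
Proof.
apply: nt_prime_order => //; first exact: threecycle_cubed.
by neq_perm4.
Qed.

Lemma order_dtransp1 : #[v] = 2.
Proof.
apply: nt_prime_order => //; first exact: dtransp1_squared.
by neq_perm4.
Qed.

Lemma order_dtransp2 : #[w] = 2.
Proof.
apply: nt_prime_order => //; first exact: dtransp2_squared.
by neq_perm4.
Qed.

Lemma dtransp_neq : v != w.
Proof. by neq_perm4. Qed.

Lemma threecycle_in_Alt : a \in 'Alt_('I_4).
Proof. by rewrite unlock4 Alt_even odd_permM !odd_tperm. Qed.

Lemma dtransp1_in_Alt : v \in 'Alt_('I_4).
Proof. by rewrite unlock4 Alt_even odd_permM !odd_tperm. Qed.

Lemma dtransp2_in_Alt : w \in 'Alt_('I_4).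
Proof. by rewrite unlock4 Alt_even odd_permM !odd_tperm. Qed.

Definition klein4 : {group {perm 'I_4}} := (<[v]> <*> <[w]>)%G.

Lemma klein4E : klein4 = <[v]> * <[w]> :> {set _}.
Proof.
by rewrite /= cent_joinEr //; apply: cents_cycle; rewrite /commute dtranspC.
Qed.

Lemma card_klein4 : #|klein4| = 4.
Proof.
rewrite klein4E TI_cardMg -?orderE ?order_dtransp1 ?order_dtransp2 //.
apply: prime_TIg; first by rewrite -orderE order_dtransp1.
rewrite cycle_subG /= (cycle2g order_dtransp2) !inE negb_or dtransp_neq andbT.
by rewrite -order_eq1 order_dtransp1.
Qed.

Lemma klein4P u :
  reflect (exists x y : bool, u = v ^+ x * w ^+ y) (u \in klein4).
Proof.
rewrite klein4E (cycle2g order_dtransp1) (cycle2g order_dtransp2).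
apply: (iffP imset2P) => [[s t /set2P s_ /set2P t_ ->] | [x [y ->]]].
  by case: s_ => ->; [exists false | exists true];
    case: t_ => ->; [exists false | exists true | exists false | exists true].
exists (v ^+ x) (w ^+ y) => //.
  by case: x; rewrite !inE eqxx ?orbT.
by case: y; rewrite !inE eqxx ?orbT.
Qed.

Lemma card_Alt4 : #|'Alt_('I_4)| = 12.
Proof. by apply: double_inj; rewrite -mul2n card_Alt card_ord. Qed.

Lemma dtransp1_klein4 : v \in klein4.
Proof. by apply/klein4P; exists true, false; rewrite mulg1. Qed.

Lemma dtransp2_klein4 : w \in klein4.
Proof. by apply/klein4P; exists false, true; rewrite mul1g. Qed.

Lemma dtransp1J : v ^ a^-1 = w.
Proof. by rewrite conjgE invgK mulgA threecycle_dtransp1 mulgK. Qed.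

Lemma dtransp2J : w ^ a^-1 = v * w.
Proof. by rewrite conjgE invgK mulgA threecycle_dtransp2 mulgK. Qed.

Lemma klein4_norm : a \in 'N(klein4).
Proof.
rewrite -groupV inE conjYg -!cycleJ join_subG !cycle_subG.
rewrite dtransp1J dtransp2J dtransp2_klein4.
by rewrite groupM ?dtransp1_klein4 ?dtransp2_klein4.
Qed.

Lemma sub_klein4_Alt : klein4 \subset 'Alt_('I_4).
Proof.
by rewrite join_subG !cycle_subG dtransp1_in_Alt dtransp2_in_Alt.
Qed.

Lemma Alt4E : 'Alt_('I_4) = klein4 * <[a]> :> {set _}.
Proof.
apply/esym/eqP; rewrite eqEcard mul_subG ?sub_klein4_Alt //; last first.
  by rewrite cycle_subG threecycle_in_Alt.
rewrite coprime_cardMg card_klein4 -orderE order_threecycle //.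
by rewrite card_Alt4.
Qed.

(** The shift by 2 accounts for the two copies of [a] that the first two sweeps contribute, so [r]
    is the exponent left to the third. *)
Lemma Alt4P g :
  g \in 'Alt_('I_4) ->
  exists u r, [/\ u \in klein4, (r < 3)%N & g = u * a ^+ (r + 2)].
Proof.
rewrite Alt4E => /mulsgP[u _ Vu /cycleP[i ->] ->].
(* Modulo 3, [(i + 1) + 2] is [i]. *)
exists u, ((i + 1) %% 3)%N; rewrite Vu ltn_mod; split=> //; congr (u * _).
by apply/eqP; rewrite eq_expg_mod_order order_threecycle modnDml -addnA modnDr.
Qed.

Lemma normal_klein4 : klein4 <| 'Alt_('I_4).
Proof.
rewrite /normal sub_klein4_Alt Alt4E mul_subG ?normG //.
by rewrite cycle_subG klein4_norm.
Qed.

Lemma card_Alt4_quotient : #|'Alt_('I_4) / klein4| = 3.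
Proof.
by rewrite -divg_normal ?normal_klein4 // card_Alt4 card_klein4.
Qed.

(** * Words in [A_4] with prescribed exponents *)

(* The exponents [r] and [s] are imposed by other coordinates; [x] and [y] are
   free, and suffice since [v] and its conjugate by [a^-1] generate klein4. *)
Lemma klein4_word u r s :
  u \in klein4 ->
  exists x y : bool,
    v ^+ x * a * v ^+ y * a * v ^+ s * a ^+ r = u * a ^+ (r + 2).
Proof.
move=> Vu.
(* Moving [v ^+ s] left past the two copies of [a] conjugates it by [a ^- 2]; this contribution is
   divided out of [u]. *)
have /klein4P[x [y def_u]] : u * ((v ^+ s) ^ (a ^- 2))^-1 \in klein4.
  by rewrite groupM ?groupV ?memJ_norm ?groupV ?groupX ?klein4_norm
             ?dtransp1_klein4.
exists x, y; rewrite -[u](mulgKV ((v ^+ s) ^ a ^- 2)).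
rewrite def_u -dtransp1J -conjXg !conjgE !invgK addnC expgD.
by rewrite [a ^- 2]invMg !mulgA !mulgKV.
Qed.

(** The pattern of coordinate 0, where [a] comes from the first generator and [v] from the last, so
    that every sweep reads [a] before [v]. *)
Lemma klein4_wordl u r s :
  u \in klein4 ->
  exists x y : bool,
    a * v ^+ x * a * v ^+ y * a ^+ r * v ^+ s = u * a ^+ (r + 2).
Proof.
move=> Vu.
(* This element is forced: carry [v ^+ s] left past [a ^+ (r + 2)], divide it out, then conjugate
   away the leading [a]. *)
have Vh : (u * (v ^- s) ^ (a ^- (r + 2))) ^ a \in klein4.
  by rewrite memJ_norm ?klein4_norm // groupM ?memJ_norm
             ?groupV ?groupX ?klein4_norm ?dtransp1_klein4.
have [x [y]] := klein4_word 0 0 Vh; rewrite !mulg1 add0n => def_h.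
exists x, y.
have -> : a * v ^+ x * a * v ^+ y = a * (v ^+ x * a * v ^+ y * a) * a^-1.
  by rewrite !mulgA mulgK.
rewrite def_h !conjgE invgK addnC expgD !invMg !mulgA mulgV mul1g mulgK.
by rewrite !mulgKV.
Qed.

(** With a single coordinate no neighbour imposes a power of [v], whence [s = 0]. *)
Lemma Alt4_word g :
  g \in 'Alt_('I_4) ->
  exists (x y : bool) (r : nat),
    (r < 3)%N /\ g = v ^+ x * a * v ^+ y * a * a ^+ r.
Proof.
case/Alt4P=> u [r [Vu lt_r3 ->]].
have [x [y <-]] := klein4_word r 0 Vu.
by exists x, y, r; rewrite mulg1.
Qed.

Lemma gen_Alt4 : <<[set a; v]>> = 'Alt_('I_4).
Proof.
apply/eqP; rewrite eqEsubset gen_subG subUset !sub1set.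
rewrite threecycle_in_Alt dtransp1_in_Alt /=.
apply/subsetP=> _ /Alt4_word[x [y [r [_ ->]]]].
have Aa : a \in <<[set a; v]>> by rewrite mem_gen ?set21.
have Av : v \in <<[set a; v]>> by rewrite mem_gen ?set22.
by rewrite !groupM ?groupX.
Qed.

Lemma grank_Alt4_le2 : ('m('Alt_('I_4)) <= 2)%N.
Proof.
by rewrite -gen_Alt4 (leq_trans (grank_min _)) // cards2; case: (_ != _).
Qed.

Lemma Alt4_noncomm : a * v != v * a.
Proof.
by rewrite threecycle_dtransp1 (inj_eq (mulIg _)) eq_sym dtransp_neq.
Qed.

(** * Sweeps and their values at a coordinate *)

Lemma dffun_prod (I : finType) (gT : finGroupType)
    (T : Type) (s : seq T) (F : T -> {dffun forall i : I, gT}) i :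
  (\prod_(x <- s) F x) i = \prod_(x <- s) F x i.
Proof. by elim/big_rec2: _ => [|x y z _ <-]; rewrite ffunE. Qed.

(** Kept as a list of letters, not a product, so that its size bounds word length. *)
HB.lock Definition sweep (T : Type) (g : nat -> T) (p : nat -> nat) n : seq T :=
  flatten [seq nseq (p i) (g i) | i <- index_iota 0 n].

Lemma prod_sweep (gT : finGroupType) (g : nat -> gT) p n :
  \prod_(x <- sweep g p n) x = \prod_(0 <= i < n) g i ^+ p i.
Proof.
rewrite sweep.unlock big_flatten big_map; apply: eq_bigr => i _.
by rewrite big_nseq iter_mulg_1.
Qed.

Lemma size_sweep (T : Type) (g : nat -> T) p n d :
  (forall i, p i <= d)%N -> (size (sweep g p n) <= n * d)%N.
Proof.
move=> le_pd; rewrite sweep.unlock size_flatten /shape -map_comp sumnE big_map.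
rewrite -[n in leqRHS]subn0 -sum_nat_const_nat leq_sum // => i _.
by rewrite /= size_nseq.
Qed.

Lemma all_sweep (T : eqType) (g : nat -> T) p n (P : pred T) :
  (forall i, i < n -> P (g i))%N -> all P (sweep g p n).
Proof.
move=> Pg; rewrite sweep.unlock; apply/allP=> x /flatten_mapP[i].
by rewrite mem_index_iota => /Pg Pgi /nseqP[-> _].
Qed.

(** Coordinate [j.+1] sees only the generators [j], through [v], and [j.+1], through [a]. *)
Lemma prod_adjacent (gT : finGroupType) (F : nat -> gT) n j :
  (j.+1 < n)%N -> (forall i, (i < n)%N -> i != j -> i != j.+1 -> F i = 1) ->
  \prod_(0 <= i < n) F i = F j * F j.+1.
Proof.
move=> lt_jn F1; rewrite (@big_cat_nat _ _ _ j) ?(ltnW (ltnW lt_jn)) //=.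
rewrite big_nat big1 => [|i /= lt_ij]; last first.
  have lt_ij1 : (i < j.+1)%N := ltnW lt_ij.
  by rewrite F1 ?ltn_eqF // (ltn_trans lt_ij1 lt_jn).
rewrite mul1g big_ltn ?(ltnW lt_jn) // big_ltn // big_nat big1 ?mulg1 // => i.
by case/andP=> lt_ji lt_in; rewrite F1 // gtn_eqF // ltnW.
Qed.

Lemma prod_ends (gT : finGroupType) (F : nat -> gT) n :
  (forall i, (0 < i <= n)%N -> F i = 1) ->
  \prod_(0 <= i < n.+2) F i = F 0 * F n.+1.
Proof.
move=> F1; rewrite big_nat_recl // big_nat_recr //= big_nat big1 ?mul1g //.
by move=> i lt_in; rewrite F1.
Qed.

(** * Generators and words for the direct power *)

Lemma grank_direct_power_Alt4 n : (n <= 'm(direct_power 'Alt_('I_4) n))%N.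
Proof.
have p3 : prime 3 by [].
have := grank_direct_power n p3 normal_klein4
          (prime_abelem p3 card_Alt4_quotient).
by rewrite card_Alt4_quotient muln1.
Qed.

(* The values at [i] and [i + 1 mod n] clash when [n = 1]. *)
Definition Alt4_gen n (i : nat) : {dffun forall _ : 'I_n, {perm 'I_4}} :=
  [ffun j : 'I_n => if j == i :> nat then a
                    else if j == i.+1 %% n :> nat then v else 1].

Lemma Alt4_gen_in n i : Alt4_gen n i \in direct_power 'Alt_('I_4) n.
Proof.
apply/setXnP=> j; rewrite ffunE; case: ifP => _; first exact: threecycle_in_Alt.
by case: ifP => _; [exact: dtransp1_in_Alt | exact: group1].
Qed.

Lemma sweep_Alt4_gen0 n p (j : 'I_n.+2) :
  j = 0 :> nat ->
  (\prod_(x <- sweep (Alt4_gen n.+2) p n.+2) x) j = a ^+ p 0 * v ^+ p n.+1.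
Proof.
move=> j0; rewrite prod_sweep dffun_prod.
under eq_bigr => i _ do rewrite dffunX ffunE j0.
rewrite prod_ends /= ?modnn // => i /andP[i_gt0 le_in].
by rewrite ltn_eqF // modn_small ?expg1n.
Qed.

Lemma sweep_Alt4_genS n p (j : 'I_n) i :
  j = i.+1 :> nat ->
  (\prod_(x <- sweep (Alt4_gen n) p n) x) j = v ^+ p i * a ^+ p i.+1.
Proof.
move=> ji; have lt_in : (i.+1 < n)%N by rewrite -ji.
rewrite prod_sweep dffun_prod.
under eq_bigr => k _ do rewrite dffunX ffunE ji.
rewrite (prod_adjacent lt_in) /= => [|k lt_kn ne_ki ne_ki1].
  by rewrite modn_small // gtn_eqF // !eqxx.
rewrite eq_sym (negPf ne_ki1).
have [lt_k1n | le_nk1] := ltnP k.+1 n.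
  by rewrite modn_small // eqSS eq_sym (negPf ne_ki) expg1n.
(* The last generator wraps around: its [v] sits at coordinate 0, which is not [i.+1]. *)
have -> : k.+1 = n by apply/eqP; rewrite eqn_leq lt_kn le_nk1.
by rewrite modnn /= expg1n.
Qed.

(* The exponents 1 and 4 agree modulo 3, the order of the three-cycle, and have
   opposite parities: they encode one bit for the double transposition while
   acting on the three-cycle in the same way. *)
Definition parity_exp (x : bool) := if x then 1%N else 4.

Lemma threecycle_parity_exp x : a ^+ parity_exp x = a.
Proof. by case: x => //=; rewrite expgS threecycle_cubed mulg1. Qed.

Lemma dtransp1_parity_exp x : v ^+ parity_exp x = v ^+ x.
Proof. by case: x => //=; rewrite (expgnA v 2 2) dtransp1_squared expg1n. Qed.

Lemma parity_exp_le4 x : (parity_exp x <= 4)%N.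
Proof. by case: x. Qed.

Lemma direct_power_Alt4_word n (g : {dffun forall _ : 'I_n.+2, {perm 'I_4}}) :
  g \in direct_power 'Alt_('I_4) n.+2 ->
  exists x y r : nat -> nat,
    [/\ forall i, (x i <= 4)%N, forall i, (y i <= 4)%N,
        forall i, (r i <= 2)%N
      & (\prod_(s <- sweep (Alt4_gen n.+2) x n.+2) s) *
        (\prod_(s <- sweep (Alt4_gen n.+2) y n.+2) s) *
        (\prod_(s <- sweep (Alt4_gen n.+2) r n.+2) s) = g].
Proof.
move=> /setXnP Gg.
(* All the [r] are fixed before any bit is chosen, since each one enters two cyclically adjacent
   coordinates. *)
have /fin_all_exists[u /fin_all_exists[r Hur]] := fun i => Alt4P (Gg i).
pose r' i := r (inord i).
(* Index [i] governs coordinate [i.+1], where generator [i] has its [v]; the last index governs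
   coordinate 0. *)
have words (i : 'I_n.+2) : exists x y : bool,
    if i.+1 < n.+2 then
      v ^+ x * a * v ^+ y * a * v ^+ r' i * a ^+ r' i.+1 = g (inord i.+1)
    else a * v ^+ x * a * v ^+ y * a ^+ r' 0 * v ^+ r' i = g ord0.
  case: (ltnP i.+1 n.+2) => _.
    by have [Vu _ ->] := Hur (inord i.+1); apply: klein4_word.
  have ord00 : ord0 = inord 0 :> 'I_n.+2 by apply: val_inj; rewrite /= inordK.
  have [Vu _ ->] := Hur ord0; rewrite ord00.
  by apply: klein4_wordl; rewrite -ord00.
have /fin_all_exists[x /fin_all_exists[y Hxy]] := words.
exists (fun i => parity_exp (x (inord i))).
exists (fun i => parity_exp (y (inord i))), r'.
split=> [i|i|i|]; rewrite ?parity_exp_le4 //.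
  by have [] := Hur (inord i).
apply/ffunP=> j; rewrite !ffunE.
have [j0 | [i ji]] : j = 0 :> nat \/ exists i, j = i.+1 :> nat.
  by case: (nat_of_ord j) => [|i]; [left | right; exists i].
  rewrite !sweep_Alt4_gen0 // !threecycle_parity_exp !dtransp1_parity_exp.
  have := Hxy ord_max; rewrite ltnn (_ : g ord0 = g j); last first.
    by congr (g _); apply: val_inj.
  have -> : inord n.+1 = ord_max :> 'I_n.+2.
    by apply: val_inj; rewrite /= inordK.
  by move <-; rewrite /r' !mulgA.
have lt_i1n : (i.+1 < n.+2)%N by rewrite -ji.
rewrite !(sweep_Alt4_genS _ ji) !threecycle_parity_exp !dtransp1_parity_exp.
have := Hxy (inord i); rewrite inordK ?lt_i1n ?(ltnW lt_i1n) //.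
rewrite (_ : inord i.+1 = j); last by apply: val_inj; rewrite /= inordK.
by move <-; rewrite !mulgA.
Qed.

(** * The cases of one and of several coordinates *)

Lemma const_direct_power (gT : finGroupType) (G : {group gT}) n h :
  h \in G ->
  ([ffun=> h] : {dffun forall _ : 'I_n, gT}) \in direct_power G n.
Proof. by move=> Gh; apply/setXnP=> i; rewrite ffunE. Qed.

Unset Implicit Arguments.

(* 'm(G) is the library's gen_rank: the least cardinality of a generating set. *)
Theorem proposition5p11 (n : nat) (hn : 0 < n) :
  exists B : {set {dffun forall i : 'I_n, {perm 'I_4}}},
    [/\ <<B>> = direct_power 'Alt_('I_4) n,
        #|B| = 'm(direct_power 'Alt_('I_4) n)
      & diam (direct_power 'Alt_('I_4) n) B
          <= n * (#|'Alt_('I_4)| - 'm('Alt_('I_4)))]%N.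
Proof.
(* Here 10 is [12 - 2], from the order of [A_4] and the bound 2 on its rank. *)
suff [B [sBG cardB words]] :
    exists B : {set {dffun forall i : 'I_n, {perm 'I_4}}},
    [/\ B \subset direct_power 'Alt_('I_4) n,
        (#|B| <= 'm(direct_power 'Alt_('I_4) n))%N
      & forall g, g \in direct_power 'Alt_('I_4) n ->
          exists2 s, all [in B] s &
            \prod_(x <- s) x = g /\ (size s <= n * 10)%N].
  pose G := direct_power_group 'Alt_('I_4) n.
  have [genB diamB] := gen_diam_le (G := G) sBG words.
  exists B; split=> //.
    (* As [B] generates, the rank is at most [#|B|], which turns [cardB] into an equality. *)
    by apply/eqP; rewrite eqn_leq cardB -{1}genB grank_min.
  apply: leq_trans diamB _; rewrite leq_mul2l card_Alt4.
  by rewrite (leq_sub2l 12 grank_Alt4_le2) orbT.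
case: n hn => [//|[|n]] _.
  pose c (h : {perm 'I_4}) : {dffun forall _ : 'I_1, {perm 'I_4}} := [ffun=> h].
  exists [set c a; c v]; split.
  - by rewrite subUset !sub1set !const_direct_power
               ?threecycle_in_Alt ?dtransp1_in_Alt.
  - rewrite cards2; apply: (@leq_trans 2); first by case: (_ != _).
    apply: (grank_gt1 (G := direct_power_group 'Alt_('I_4) 1)).
    apply: contra Alt4_noncomm => /centsP/(_ (c a) _ (c v)) cav.
    have := cav (const_direct_power _ threecycle_in_Alt)
                (const_direct_power _ dtransp1_in_Alt).
    by move/ffunP/(_ ord0); rewrite !ffunE => ->.
  move=> g /setXnP/(_ ord0)/Alt4_word[x [y [r [lt_r3 def_g]]]].
  (* At most [1 + 1 + 1 + 1 + 2 = 6] letters. *)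
  exists (nseq x (c v) ++ [:: c a] ++ nseq y (c v) ++ [:: c a] ++ nseq r (c a)).
    by rewrite !all_cat !all_nseq /= set21 set22 !orbT.
  split; last first.
    rewrite !size_cat !size_nseq /=.
    by case: x y {def_g} => [] []; case: r lt_r3 => [|[|[|]]].
  apply/ffunP=> i; rewrite ord1 def_g !big_cat !big_seq1 !big_nseq !iter_mulg_1.
  by rewrite !ffunE !dffunX !ffunE !mulgA.
exists [set Alt4_gen n.+2 i | i : 'I_n.+2]; split.
- by apply/subsetP=> _ /imsetP[i _ ->]; apply: Alt4_gen_in.
- apply: leq_trans (leq_imset_card _ _) _.
  by rewrite card_ord grank_direct_power_Alt4.
move=> g /direct_power_Alt4_word[x [y [r [le_x4 le_y4 le_r2 def_g]]]].
exists (sweep (Alt4_gen n.+2) x n.+2 ++ sweep (Alt4_gen n.+2) y n.+2 ++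
        sweep (Alt4_gen n.+2) r n.+2).
  rewrite !all_cat !all_sweep // => i lt_in;
  by apply/imsetP; exists (Ordinal lt_in).
split; first by rewrite -def_g -mulgA; do 2!rewrite big_cat; congr (_ * _).
(* The three sweeps have exponents at most 4, 4 and 2. *)
rewrite !size_cat (_ : n.+2 * 10 = n.+2 * 4 + (n.+2 * 4 + n.+2 * 2))%N.
  by rewrite !leq_add ?size_sweep.
by rewrite -!mulnDr.
Qed.
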